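(* Let $K$ be a field, $S=K[t_1,\ldots,t_s]$, let $d\geq 1$, and let $\mathcal{C}$ be a $d$-uniform clutter with vertex set $V(\mathcal{C})=\{t_1,\ldots,t_s\}$ and ideal of covers $I_c(\mathcal{C})\subset S$. If $I_c(\mathcal{C})^{(d)}=I_c(\mathcal{C})^{d}$ and $\mathcal{C}$ has no isolated vertices, then there are mutually disjoint minimal vertex covers $C_1,\ldots,C_d$ of $\mathcal{C}$ such that $V(\mathcal{C})=\bigcup_{i=1}^d C_i$ and every edge of $\mathcal{C}$ has the form $e=\{t_{i_1},\ldots,t_{i_d}\}$, where $t_{i_j}\in C_j$ for all $j=1,\ldots,d$.
   Context: A clutter $\mathcal{C}$ with vertex set $V(\mathcal{C})$ is a family $E(\mathcal{C})$ of subsets of $V(\mathcal{C})$, called edges, none of which is contained in another. It is $d$-uniform if $|e|=d$ for every edge $e$. A vertex is isolated if it lies in no edge. A vertex cover is a set of vertices $C$ such that every edge contains at least one vertex of $C$; a minimal vertex cover is one minimal with respect to inclusion. The ideal of covers $I_c(\mathcal{C})$ is the ideal of $S$ generated by all monomials $\prod_{t_i\in C}t_i$ with $C$ a minimal vertex cover of $\mathcal{C}$. For an ideal $I\subset S$ and $n\geq 1$, the $n$-th symbolic power is $I^{(n)}:=\bigcap_{\mathfrak{p}\in\mathrm{minAss}(I)}(I^nS_{\mathfrak{p}}\cap S)$, where $\mathrm{minAss}(I)$ is the set of inclusion-minimal elements of the set $\mathrm{Ass}(I)$ of associated primes of $I$ (primes of the form $(I\colon f)$, $f\in S$). *)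

(* Defs.v *)
From mathcomp Require Import all_boot all_order all_algebra.
From mathcomp.multinomials Require Export mpoly.

Set Implicit Arguments.
Unset Strict Implicit.
Unset Printing Implicit Defensive.

Import GRing.Theory.
Local Open Scope ring_scope.

(** Ideals are [Prop]-valued predicates: the [idealr] structures of
    [ring_quotient] are boolean, hence restricted to decidable, and moreover
    proper, ideals. *)

Section Ideals.
Variable R : comNzRingType.
Implicit Types I J p q : R -> Prop.

Definition is_ideal I : Prop :=
  [/\ I 0, forall x y, I x -> I y -> I (x + y) & forall a x, I x -> I (a * x)].

Definition prime_ideal p : Prop :=
  [/\ is_ideal p, ~ p 1 & forall x y, p (x * y) -> p x \/ p y].

Definition ideal_gen (G : R -> Prop) : R -> Prop :=
  fun x => forall J, is_ideal J -> (forall g, G g -> J g) -> J x.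

Definition ideal_pow I (n : nat) : R -> Prop :=
  ideal_gen (fun x => exists f : 'I_n -> R,
    (forall i, I (f i)) /\ x = \prod_(i < n) f i).

Definition colon I (f : R) : R -> Prop := fun g => I (g * f).

Definition Ass I p : Prop :=
  prime_ideal p /\ exists f, forall g, p g <-> colon I f g.

Definition minAss I p : Prop :=
  Ass I p /\
  forall q, Ass I q -> (forall x, q x -> p x) -> forall x, p x -> q x.

End Ideals.

Section SymbolicPowers.
Variable R : idomainType.
Implicit Types I J p : R -> Prop.

(** The localization of the domain [R] at a prime [p], as a subring of the
    fraction field.  Denominators are nonzero since [0] lies in [p]. *)
Definition localization p : {fraction R} -> Prop :=
  fun z => exists a b : R, ~ p b /\ z = tofrac a / tofrac b.

(** The extension of [J] to the localization: the ideal of [localization p]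
    generated by the image of [J]. *)
Definition extension J p : {fraction R} -> Prop :=
  fun z => forall M : {fraction R} -> Prop,
    M 0 ->
    (forall x y, M x -> M y -> M (x + y)) ->
    (forall a x, localization p a -> M x -> M (a * x)) ->
    (forall x, J x -> M (tofrac x)) ->
    M z.

Definition contraction_of_extension J p : R -> Prop :=
  fun x => extension J p (tofrac x).

Definition symbolic_pow I (n : nat) : R -> Prop :=
  fun x => forall p, minAss I p -> contraction_of_extension (ideal_pow I n) p x.

End SymbolicPowers.

Section Clutters.
Variable V : finType.
Implicit Types (E : {set {set V}}) (C : {set V}).

Definition clutter E : Prop :=
  forall e e', e \in E -> e' \in E -> e \subset e' -> e = e'.

Definition uniform (d : nat) E : Prop := forall e, e \in E -> #|e| = d.

Definition isolated E (v : V) : Prop := forall e, e \in E -> v \notin e.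

Definition vertex_cover E : pred {set V} :=
  fun C => [forall e in E, [exists v in e, v \in C]].

Definition minimal_vertex_cover E C : bool := minset (vertex_cover E) C.

End Clutters.

(** The variable [t_i] of [K[t_1, ..., t_s]] is identified with its index, so
    that the vertex set is ['I_s]. *)
Definition ideal_of_covers (K : fieldType) (s : nat) (E : {set {set 'I_s}}) :
    {mpoly K[s]} -> Prop :=
  ideal_gen (fun m => exists2 C : {set 'I_s},
    minimal_vertex_cover E C & m = \prod_(i in C) 'X_i).
Arguments ideal_of_covers K {s} E _.

(* Main.v *)
Require Import Defs.
From HB Require Import structures.
From mathcomp Require Import all_boot all_order all_algebra.
From Stdlib Require Classical_Prop.

Set Implicit Arguments.
Unset Strict Implicit.
Unset Printing Implicit Defensive.

Local Open Scope ring_scope.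

(** The whole argument is about one polynomial, the product [f] of all the
    variables.  Write [I] for the ideal of covers and [P_e] for the prime
    generated by the variables of an edge [e].

    The product [f] lies in the symbolic power [I^(d)].  Put
    [u_e = \prod_(i notin e) t_i].  Since no edge other than [e] is contained
    in [e], the set [(V \ e) + i] is a vertex cover for each [i] in [e], so
    [t_i u_e] is in [I] ([edge_variable_mul_cover]).  This has two
    consequences.  First, [P_e = (I : u_e)] is an associated prime
    ([edge_prime_Ass]); as every prime containing [I] contains some [P_e]
    ([prime_contains_edge]), the minimal associated primes avoid some [u_e]
    ([minAss_avoids_edge_compl]).  Secondly, multiplying over the [d] elements
    of [e], the element [f u_e^d] is in [I^d]
    ([prod_variables_mul_compl]), and [u_e] is invertible in the localization
    ([prod_variables_symbolic_pow]).

    By hypothesis [f] then lies in [I^d].  All monomials of elements of [I^d]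
    are divisible by a product of [d] cover monomials ([ideal_pow_supported]).
    As [f] is a squarefree monomial, this produces [d] pairwise disjoint
    minimal covers.  An edge has [d] vertices and meets each of the [d]
    disjoint covers, hence meets each exactly once and has no vertex outside
    them ([edge_transversal]); without isolated vertices the covers thus
    exhaust the vertex set. *)

Import GRing.Theory.

(** * Generated ideals, primes and localization *)

Section IdealFacts.
Variable R : comNzRingType.
Implicit Types (I J p G : R -> Prop) (f g x : R).

Lemma ideal_genW G x : G x -> ideal_gen G x.
Proof. by move=> Gx J _; apply. Qed.

Lemma ideal_gen_ideal G : is_ideal (ideal_gen G).
Proof.
split=> [J [] //|x y Gx Gy J idJ GJ|a x Gx J idJ GJ].
  by case: (idJ) => _ + _; apply; [apply: Gx | apply: Gy].
by case: (idJ) => _ _; apply; apply: Gx.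
Qed.

Lemma colon_ideal I f : is_ideal I -> is_ideal (colon I f).
Proof.
move=> [I0 ID IM]; split; rewrite /colon ?mul0r //.
  by move=> x y Ix Iy; rewrite mulrDl; apply: ID.
by move=> a x Ix; rewrite -mulrA; apply: IM.
Qed.

Lemma prime_ideal_prod p (T : finType) (A : {pred T}) (F : T -> R) :
  prime_ideal p -> p (\prod_(i in A) F i) -> exists2 i, i \in A & p (F i).
Proof.
move=> [_ p1 pM] pAF; apply: Classical_Prop.NNPP => noF.
apply: (big_ind (fun x => ~ p x)) pAF => // [x y px py|i Ai pFi].
  by move=> /pM[].
by apply: noF; exists i.
Qed.

Lemma prime_ideal_expN p x n : prime_ideal p -> ~ p x -> ~ p (x ^+ n).
Proof.
move=> pp px; rewrite -[n in _ ^+ n]card_ord -prodr_const.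
by move=> /(prime_ideal_prod pp)[].
Qed.

End IdealFacts.

Lemma contraction_of_extension_mulr (R : idomainType) (J p : R -> Prop) x b :
  prime_ideal p -> ~ p b -> J (x * b) -> contraction_of_extension J p x.
Proof.
move=> [[p0 _ _] _ _] pb Jxb M _ _ Mmul MJ.
have b0 : b != 0 by apply/eqP=> b0; apply: pb; rewrite b0.
have -> : tofrac x = tofrac 1 / tofrac b * tofrac (x * b).
  by rewrite tofrac1 mul1r tofracM [tofrac x * _]mulrC mulKf ?tofrac_eq0.
by apply: Mmul; [exists 1, b | exact: MJ].
Qed.

(** * Ideals of multivariate polynomials *)

Section PolynomialIdeals.
Variables (K : fieldType) (s : nat).
Implicit Types (f g : {mpoly K[s]}) (J : {mpoly K[s]} -> Prop).
Implicit Types (A C e : {set 'I_s}).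

Definition supported_in (A : 'X_{1..s} -> Prop) f : Prop :=
  forall m, m \in msupp f -> A m.

Lemma supported_in_ideal (A : 'X_{1..s} -> Prop) :
  (forall k m, A m -> A (k + m)%MM) -> is_ideal (supported_in A).
Proof.
move=> Aup; split=> [m|f g Af Ag m|a f Af m].
- by rewrite mcoeff_msupp mcoeff0 eqxx.
- by move=> /msuppD_le; rewrite mem_cat => /orP[/Af|/Ag].
- by move=> /msuppM_le/allpairsP[[k l] /= [_ fl ->]]; apply/Aup/Af.
Qed.

Lemma msupp_prod n (f : 'I_n -> {mpoly K[s]}) m :
  m \in msupp (\prod_i f i) ->
  exists2 k : 'I_n -> 'X_{1..s},
    forall i, k i \in msupp (f i) & m = (\sum_i k i)%MM.
Proof.
elim: n f m => [|n IHn] f m.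
  rewrite big_ord0 msupp1 inE => /eqP->; exists (fun=> 0%MM) => [[]//|].
  by rewrite big_ord0.
rewrite big_ord_recl => /msuppM_le/allpairsP[[k0 l] /= [fk0 /IHn[k fk ->] ->]].
exists (fun i => if unlift ord0 i is Some j then k j else k0) => [i|].
  by case: unliftP => [j|] ->.
rewrite big_ord_recl unlift_none; congr (_ + _)%MM.
by apply: eq_bigr => i _; rewrite liftK.
Qed.

Lemma prod_variables_mpolyX A :
  \prod_(i in A) 'X_i = 'X_[[multinom (i \in A : nat) | i < s]] :> {mpoly K[s]}.
Proof.
rewrite mpolyXE_id big_mkcond; apply: eq_bigr => i _.
by rewrite mnmE; case: (i \in A).
Qed.

(** The substitution killing the variables of [e]; its kernel is the ideal
    generated by these variables, and being a kernel of a morphism to a domain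
    makes it visibly prime. *)
Definition kill_variables e : {mpoly K[s]} -> {mpoly K[s]} :=
  comp_mpoly [tuple if i \in e then 0 else 'X_i | i < s].

HB.instance Definition _ e :=
  GRing.RMorphism.copy (kill_variables e) (kill_variables e).

Definition variables_ideal e : {mpoly K[s]} -> Prop :=
  fun f => kill_variables e f = 0.

Lemma kill_variablesX e i :
  kill_variables e 'X_i = if i \in e then 0 else 'X_i.
Proof. by rewrite /kill_variables comp_mpolyXU -tnth_nth tnth_mktuple. Qed.

Lemma variables_ideal_prime e : prime_ideal (variables_ideal e).
Proof.
rewrite /variables_ideal; split; [split| |].
- exact: rmorph0.
- by move=> x y x0 y0; rewrite rmorphD /= x0 y0 addr0.
- by move=> a x x0; rewrite rmorphM /= x0 mulr0.
- by rewrite rmorph1; apply/eqP/oner_neq0.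
- by move=> x y /eqP; rewrite rmorphM mulf_eq0 => /orP[]/eqP; [left|right].
Qed.

Lemma variables_idealX e i : i \in e -> variables_ideal e 'X_i.
Proof. by move=> ei; rewrite /variables_ideal kill_variablesX ei. Qed.

Lemma mpolyX_neq0 m : 'X_[m] != 0 :> {mpoly K[s]}.
Proof. by rewrite -msupp_eq0 msuppX. Qed.

(** Modulo an ideal containing the variables of [e], the substitution acts as
    the identity: the polynomials it fixes modulo [J] form a subring containing
    the constants and the variables. *)
Lemma variables_ideal_sub e J f : is_ideal J ->
  (forall i, i \in e -> J 'X_i) -> variables_ideal e f -> J f.
Proof.
move=> [J0 JD JM] JX f0.
suff: J (f - kill_variables e f) by rewrite f0 subr0.
rewrite (mpolyE f).
pose fixedJ g := J (g - kill_variables e g).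
have fixedM g h : fixedJ g -> fixedJ h -> fixedJ (g * h).
  rewrite /fixedJ rmorphM => Jg Jh.
  rewrite -[g * h](subrK (kill_variables e g * h)) -mulrBl -addrA -mulrBr.
  by rewrite mulrC; apply: JD; apply: JM.
apply: (big_ind fixedJ); first by rewrite /fixedJ rmorph0 subrr.
  by move=> g h Jg Jh; rewrite /fixedJ rmorphD opprD addrACA; apply: JD.
move=> m _; rewrite -mul_mpolyC; apply: (fixedM).
  by rewrite /fixedJ /kill_variables comp_mpolyC subrr.
rewrite mpolyXE_id; apply: (big_ind fixedJ) => [||i _]; [|exact: fixedM|].
  by rewrite /fixedJ rmorph1 subrr.
elim: (m i) => [|n IHn]; first by rewrite expr0 /fixedJ rmorph1 subrr.
rewrite exprS; apply: (fixedM) => //.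
rewrite /fixedJ kill_variablesX; case: ifP => ei; rewrite ?subrr ?subr0 //.
exact: JX.
Qed.

End PolynomialIdeals.

(** * The ideal of covers *)

Section IdealOfCovers.
Variables (K : fieldType) (s : nat) (E : {set {set 'I_s}}).
Implicit Types (C e : {set 'I_s}) (p : {mpoly K[s]} -> Prop).

Local Notation I := (ideal_of_covers K E).
Local Notation compl_monomial e := (\prod_(i in ~: e) 'X_i : {mpoly K[s]}).

Lemma vertex_coverP C :
  reflect (forall e, e \in E -> exists2 v, v \in e & v \in C)
          (vertex_cover E C).
Proof.
apply: (iffP forall_inP) => covC e eE; first exact/exists_inP/covC.
exact/exists_inP/covC.
Qed.

Lemma minimal_vertex_cover_cover C :
  minimal_vertex_cover E C -> vertex_cover E C.
Proof. exact: minsetp. Qed.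

Lemma vertex_cover_monomial C : vertex_cover E C -> I (\prod_(i in C) 'X_i).
Proof.
move=> /minset_exists[C0 minC0 sC0C].
rewrite (big_setID C0) /= (setIidPr sC0C) mulrC.
have [_ _] := ideal_gen_ideal (fun m : {mpoly K[s]} =>
  exists2 C : {set 'I_s}, minimal_vertex_cover E C & m = \prod_(i in C) 'X_i).
by apply; apply: ideal_genW; exists C0.
Qed.

Lemma edge_variable_mul_cover e i : clutter E -> e \in E -> i \in e ->
  I ('X_i * compl_monomial e).
Proof.
move=> clE eE ei.
rewrite -(big_setU1 _ (F := fun i => 'X_i : {mpoly K[s]})) ?inE ?ei //=.
apply: vertex_cover_monomial; apply/vertex_coverP => e' e'E.
have [se'e|/subsetPn[v e'v ev]] := boolP (e' \subset e).
  by exists i; rewrite ?setU11 // (clE e' e).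
by exists v; rewrite // !inE ev orbT.
Qed.

Lemma ideal_of_covers_sub_edge e f : e \in E -> I f -> variables_ideal e f.
Proof.
move=> eE; apply=> [|_ [C /minimal_vertex_cover_cover/vertex_coverP covC ->]].
  by case: (variables_ideal_prime K e).
have [v ev Cv] := covC e eE.
have [[_ _ eM] _ _] := variables_ideal_prime K e.
by rewrite (bigD1 v) //= mulrC; apply/eM/variables_idealX.
Qed.

Lemma compl_monomial_notin_edge e : ~ variables_ideal e (compl_monomial e).
Proof.
move=> /(prime_ideal_prod (variables_ideal_prime K e))[i].
rewrite inE /variables_ideal kill_variablesX => /negPf-> /eqP.
by rewrite (negPf (mpolyX_neq0 _ _)).
Qed.

Lemma edge_prime_Ass e : clutter E -> e \in E -> Ass I (variables_ideal e).
Proof.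
move=> clE eE; split; first exact: variables_ideal_prime.
exists (compl_monomial e) => g; split.
  apply: variables_ideal_sub; first exact/colon_ideal/ideal_gen_ideal.
  by move=> i; apply: edge_variable_mul_cover.
move=> /(ideal_of_covers_sub_edge eE).
have [_ _ pM] := variables_ideal_prime K e.
by move=> /pM[//|/compl_monomial_notin_edge].
Qed.

(** Otherwise each edge has a variable outside [p]; these form a cover, whose
    monomial lies in [I] but not in [p]. *)
Lemma prime_contains_edge p : prime_ideal p -> (forall f, I f -> p f) ->
  exists2 e, e \in E & forall i, i \in e -> p 'X_i.
Proof.
move=> pp Ip; apply: Classical_Prop.NNPP => noe.
have [C CP] : exists C : 'I_s -> bool, forall i, C i <-> ~ p 'X_i.
  apply: (fin_all_exists (P := fun i b => is_true b <-> ~ p 'X_i)) => i.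
  by case: (Classical_Prop.classic (p 'X_i)) => pi; [exists false|exists true].
have covC : vertex_cover E [set i | C i].
  apply/vertex_coverP => e eE; apply: Classical_Prop.NNPP => noi.
  apply: noe; exists e => // i ei; apply: Classical_Prop.NNPP => /CP Ci.
  by apply: noi; exists i; rewrite ?inE.
have [i] := prime_ideal_prod pp (Ip _ (vertex_cover_monomial covC)).
by rewrite inE => /CP.
Qed.

Lemma minAss_avoids_edge_compl p : clutter E -> minAss I p ->
  exists2 e, e \in E & ~ p (compl_monomial e).
Proof.
move=> clE [[pp [g pg]] minp].
have [_ _ IM] := ideal_gen_ideal (fun m : {mpoly K[s]} =>
  exists2 C : {set 'I_s}, minimal_vertex_cover E C & m = \prod_(i in C) 'X_i).
have [f If|e eE pe] := prime_contains_edge pp.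
  by apply/pg; rewrite /colon mulrC; apply: IM.
exists e => // pu; apply: (@compl_monomial_notin_edge e).
apply: minp pu; first exact: edge_prime_Ass.
by move=> f; apply: variables_ideal_sub => //; case: pp.
Qed.

(** Distributing the [#|e|] copies of the complementary monomial among the
    variables of [e]; the remaining factor only enlarges the product. *)
Lemma prod_variables_mul_compl e : clutter E -> e \in E ->
  ideal_pow I #|e| ((\prod_i 'X_i) * compl_monomial e ^+ #|e|).
Proof.
move=> clE eE; rewrite (bigID (mem e)) /=.
under [X in _ * X * _]eq_bigl => i do rewrite -in_setC.
rewrite [X in X * _]mulrC -mulrA.
have [_ _ powM] := ideal_gen_ideal (fun x : {mpoly K[s]} =>
  exists f : 'I_#|e| -> _, (forall i, I (f i)) /\ x = \prod_(i < #|e|) f i).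
apply: powM; apply: ideal_genW.
exists (fun j => 'X_(enum_val j) * compl_monomial e); split=> [j|].
  by apply: edge_variable_mul_cover => //; apply: enum_valP.
rewrite big_split /= prodr_const card_ord; congr (_ * _).
exact: (big_enum_val (fun i => 'X_i)).
Qed.

Lemma prod_variables_symbolic_pow d : clutter E -> uniform d E ->
  symbolic_pow I d (\prod_i 'X_i).
Proof.
move=> clE unifE p minp.
have pp : prime_ideal p by case: minp => [[]].
have [e eE pu] := minAss_avoids_edge_compl clE minp.
apply: contraction_of_extension_mulr (prime_ideal_expN (n := d) pp pu) _ => //.
by rewrite -(unifE e eE); apply: prod_variables_mul_compl.
Qed.

Lemma ideal_of_covers_supported f : I f ->
  supported_in (fun m => exists2 C : {set 'I_s}, minimal_vertex_cover E C &
                         forall i, ((i \in C) <= m i)%N) f.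
Proof.
apply; first apply: supported_in_ideal => k m [C minC Cm].
  by exists C => // i; rewrite mnmDE (leq_trans (Cm i)) ?leq_addl.
move=> _ [C minC ->] m; rewrite prod_variables_mpolyX msuppX inE => /eqP->.
by exists C => // i; rewrite mnmE.
Qed.

Lemma ideal_pow_supported d f : ideal_pow I d f ->
  supported_in (fun m => exists2 C : 'I_d -> {set 'I_s},
    forall j, minimal_vertex_cover E (C j) &
    forall i, (\sum_j (i \in C j) <= m i)%N) f.
Proof.
apply; first apply: supported_in_ideal => k m [C minC Cm].
  by exists C => // i; rewrite mnmDE (leq_trans (Cm i)) ?leq_addl.
move=> _ [h [Ih ->]] m /msupp_prod[k hk ->].
have [C CP] := fin_all_exists2 (fun j => ideal_of_covers_supported (Ih j) (hk j)).
by exists C => // i; rewrite mnm_sumE leq_sum.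
Qed.

(** Each of the [#|e|] disjoint covers takes at least one vertex of [e], so by
    counting the chosen vertices are all of [e]. *)
Lemma edge_transversal e (C : 'I_#|e| -> {set 'I_s}) : e \in E ->
  (forall j, vertex_cover E (C j)) ->
  (forall j k, j != k -> [disjoint C j & C k]) ->
  exists t : 'I_#|e| -> 'I_s,
    e = [set t j | j : 'I_#|e|] /\ forall j, t j \in C j.
Proof.
move=> eE covC disjC.
have [t et Ct] := fin_all_exists2 (fun j => vertex_coverP _ (covC j) e eE).
exists t; split=> //.
have t_inj : injective t.
  move=> j k tjk; apply/eqP; apply: contraT => /disjC/disjointFr/(_ (Ct j)).
  by rewrite tjk Ct.
apply/esym/eqP; rewrite eqEcard card_imset // card_ord leqnn andbT.
by apply/subsetP => _ /imsetP[j _ ->].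
Qed.

End IdealOfCovers.

Theorem theorem6p1 (K : fieldType) (s d : nat) (E : {set {set 'I_s}})
  (d_ge1 : (1 <= d)%N)
  (clutterE : clutter E)
  (uniformE : uniform d E)
  (symbE : forall f : {mpoly K[s]},
     symbolic_pow (ideal_of_covers K E) d f <->
     ideal_pow (ideal_of_covers K E) d f)
  (no_isolated : forall v : 'I_s, ~ isolated E v) :
  exists C : 'I_d -> {set 'I_s},
    [/\ forall j, minimal_vertex_cover E (C j),
        forall j k, j != k -> [disjoint C j & C k],
        [set: 'I_s] = \bigcup_(j < d) C j
      & forall e, e \in E ->
          exists t : 'I_d -> 'I_s,
            e = [set t j | j : 'I_d] /\ forall j, t j \in C j].
Proof.
have /symbE := prod_variables_symbolic_pow (K := K) clutterE uniformE.
have -> : \prod_i 'X_i = \prod_(i in [set: 'I_s]) 'X_i :> {mpoly K[s]}.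
  by apply: eq_bigl => i; rewrite inE.
move=> /ideal_pow_supported.
rewrite prod_variables_mpolyX => /(_ [multinom (i \in [set: 'I_s] : nat) | i < s]).
rewrite msuppX inE eqxx => /(_ isT)[C minC sumC].
have covC j : vertex_cover E (C j) by apply: minimal_vertex_cover_cover.
have disjC j k : j != k -> [disjoint C j & C k].
  move=> jk; rewrite -setI_eq0; apply/eqP/setP => i; rewrite !inE.
  apply/negP => /andP[Cji Cki]; have := sumC i.
  by rewrite mnmE inE (bigD1 j) //= (bigD1 k) 1?eq_sym //= Cji Cki.
have transE e : e \in E -> exists t : 'I_d -> 'I_s,
    e = [set t j | j : 'I_d] /\ forall j, t j \in C j.
  move=> eE; have := uniformE e eE => de.
  by case: _ / de C {minC sumC} covC disjC => C *; apply: edge_transversal eE _ _.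
exists C; split=> //; apply/esym/eqP; rewrite -subTset; apply/subsetP => v _.
have [/exists_inP[e eE ev]|noe] := boolP [exists e in E, v \in e]; last first.
  case: (no_isolated v) => e eE; apply: contra noe => ev.
  by apply/exists_inP; exists e.
have [t [et Ct]] := transE e eE.
by move: ev; rewrite et => /imsetP[j _ ->]; apply/bigcupP; exists j.
Qed.
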